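(* Let $x,y\in X$ satisfy $1<\partial(x,y)<k$ and write $i=\partial(x,y)$. The inner products between pairs of the vectors $\widehat{x},\widehat{y},B_{xy},C_{xy}$ are as follows: $$\langle\widehat{x},\widehat{x}\rangle=\langle\widehat{y},\widehat{y}\rangle=q^k[k][n-k],\qquad \langle\widehat{x},\widehat{y}\rangle=[n][k-i]-[k]^2,$$ $$\langle B_{xy},\widehat{x}\rangle=q^{2i+1}[k-i][n-k-i]\bigl([n][k-1]-[k]^2\bigr),\qquad \langle C_{xy},\widehat{x}\rangle=[i]^2\bigl([n][k-1]-[k]^2\bigr),$$ $$\langle B_{xy},\widehat{y}\rangle=q^{2i+1}[k-i][n-k-i]\bigl([n][k-i-1]-[k]^2\bigr),\qquad \langle C_{xy},\widehat{y}\rangle=[i]^2\bigl([n][k-i+1]-[k]^2\bigr),$$ $$\langle B_{xy},B_{xy}\rangle=q^{4i+2}[k-i][n-k-i]\Bigl(q^{k-i-2}[n]\bigl([k-i]+[n-k-i]\bigr)+[k-i][n-k-i]\bigl([n][k-2]-[k]^2\bigr)\Bigr),$$ $$\langle B_{xy},C_{xy}\rangle=q^{2i+1}[k-i][n-k-i][i]^2\bigl([n][k-2]-[k]^2\bigr),$$ $$\langle C_{xy},C_{xy}\rangle=[i]^2\Bigl(q^{k-2}[n]\bigl(2q[i-1]+q+1\bigr)+[i]^2\bigl([n][k-2]-[k]^2\bigr)\Bigr).$$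
   Context: Let $\mathbb{F}_q$ be a finite field with $q$ elements, let $n,k$ be integers with $n>2k\geq 6$, and let $V$ be an $n$-dimensional vector space over $\mathbb{F}_q$. For $m\in\mathbb{Z}$ write $[m]=(q^m-1)/(q-1)$. Let $P$ be the set of all subspaces of $V$ and $P_\ell$ the set of $\ell$-dimensional subspaces; put $X=P_k$. The Grassmann graph $\Gamma=J_q(n,k)$ has vertex set $X$, with $x,y\in X$ adjacent iff $\dim(x\cap y)=k-1$; $\partial$ is its path-length distance and $\Gamma(x)$ is the set of neighbours of $x$. Let $E$ be a (real) Euclidean space of dimension $[n]-1$ with inner product $\langle\,,\,\rangle$, and let $P_1\to E$, $s\mapsto\widehat{s}$ be a map such that: $E=\mathrm{Span}\{\widehat{s}\mid s\in P_1\}$; $\|\widehat{s}\|^2=[n]-1$ for $s\in P_1$; $\langle\widehat{s},\widehat{t}\rangle=-1$ for distinct $s,t\in P_1$; and $\sum_{s\in P_1}\widehat{s}=0$. For $u\in P$ define $\widehat{u}=\sum_{s\in P_1,\,s\subseteq u}\widehat{s}$. For $x,y\in X$ with $1<\partial(x,y)<k$ define $\mathcal{B}_{xy}=\{z\in\Gamma(x)\mid\partial(y,z)=\partial(x,y)+1\}$, $\mathcal{C}_{xy}=\{z\in\Gamma(x)\mid\partial(y,z)=\partial(x,y)-1\}$, and $B_{xy}=\sum_{z\in\mathcal{B}_{xy}}\widehat{z}$, $C_{xy}=\sum_{z\in\mathcal{C}_{xy}}\widehat{z}$. *)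

(* Defs.v *)
From HB Require Import structures.
From mathcomp Require Import all_boot all_order all_algebra.
From mathcomp Require Import reals.

Set Implicit Arguments.
Unset Strict Implicit.
Unset Printing Implicit Defensive.

Import Order.TTheory GRing.Theory Num.Theory.
Local Open Scope ring_scope.

(* vector.v stores a subspace as a square matrix, but declares only a choiceType
   structure on {vspace V}; over a finite field there are finitely many. *)
Section FiniteSubspaces.
Variables (F : finFieldType) (V : vectType F).
Let mxK := @VectorInternalTheory.vs2mxK F V.
HB.instance Definition _ : isCountable {vspace V} := CanIsCountable mxK.
HB.instance Definition _ : isFinite {vspace V} := CanIsFinite mxK.
End FiniteSubspaces.

Notation subspace V l := {u : {vspace V} | \dim u == l%N}.

(* The least length of an e-path from x to y. Such a path can be taken of
   length < #|T|; the value is #|T| when there is no path. *)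
Definition gdist (T : finType) (e : rel T) (x y : T) : nat :=
  find (fun m => [exists p : m.-tuple T, path e x p && (last x p == y)])
       (iota 0 #|T|).

Definition qbracket (R : fieldType) (q : R) (m : int) : R :=
  (q ^ m - 1) / (q - 1).

Section Grassmann.
Variables (F : finFieldType) (V : vectType F) (k : nat).
Implicit Types x y z : subspace V k.

Definition grassmann : rel (subspace V k) :=
  fun x y => \dim (val x :&: val y) == (k - 1)%N.

Definition calB x y : {set subspace V k} :=
  [set z | grassmann x z &
           gdist grassmann y z == (gdist grassmann x y + 1)%N].

Definition calC x y : {set subspace V k} :=
  [set z | grassmann x z &
           gdist grassmann y z == (gdist grassmann x y - 1)%N].

Variables (R : realType) (E : vectType R) (h : subspace V 1 -> E).

Definition hat (u : {vspace V}) : E :=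
  \sum_(s : subspace V 1 | (val s <= u)%VS) h s.

Definition vecB x y : E := \sum_(z in calB x y) hat (val z).
Definition vecC x y : E := \sum_(z in calC x y) hat (val z).

End Grassmann.

(* Main.v *)
Require Import Defs.
From HB Require Import structures.
From mathcomp Require Import all_boot all_order all_algebra all_field.
From mathcomp Require Import reals.
From mathcomp Require Import zify ring.

Import Order.TTheory GRing.Theory Num.Theory.
Local Open Scope ring_scope.

(** Write [m] for (q^m - 1) / (q - 1). The hypotheses on the vectors attached
    to points say that <s, t> = [n] (s == t) - 1, and a d-dimensional subspace
    has [d] points, so by bilinearity (dot_hat)

      <u, w> = [n] [dim (u :&: w)] - [dim u] [dim w]

    for all subspaces u and w. Every inner product of the theorem is therefore
    a sum, over pairs of vertices of the graph, of a function of the dimension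
    of an intersection. The distance between two vertices is k minus the
    dimension of their intersection (gdist_grassmann), so the neighbours u of x
    that are farther from y (closer to y) are those for which u :&: y has
    dimension one less (one more) than x :&: y. This makes the intersection
    dimensions constant in every product except <B, B> and <C, C>, and leaves
    only the cardinalities of the two sets of neighbours to be found.

    For <B, B> and <C, C>, a neighbour u of x is recorded by the hyperplane
    x :&: u of x and by the cover x + u of x. Two neighbours u and w that differ
    in both meet in dimension k - 2; if they share either one, and u <> w, they
    meet in dimension k - 1. Hence (sum_br_cap) the double sum of
    [dim (u :&: w)] over a set S of neighbours depends only on how many members
    of S share the hyperplane, the cover, or both, with a given one. For the
    two sets at hand, those sharing one of the two are the subspaces one
    dimension above the bottom, or one below the top, of an interval of the
    subspace lattice, or a difference of two such families:

    - farther neighbours are the u that neither contain x :&: y nor lie in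
      x + y (fartherE), so that fixing the hyperplane H gives the covers of H
      that do not lie in x + y, and fixing the cover U gives the hyperplanes of
      U that do not contain x :&: y;
    - closer neighbours are the u = (x :&: u) + (u :&: y) that contain
      x :&: y (closerP); fixing the hyperplane H gives the covers of H inside
      H + y, and fixing the cover U gives the hyperplanes of U containing
      U :&: y.

    Sharing both leaves q farther neighbours and a single closer one. In an
    interval of length d there are [d] subspaces of either kind (atoms_br,
    coatoms_br). The rest is algebra of rational functions in q, q^n, q^k and
    q^i. *)

(** * Covers and hyperplanes in an interval of subspaces *)

Section Counting.
Context {F : finFieldType} {V : vectType F}.
Implicit Types a b u v w : {vspace V}.

Definition atoms a b : {set {vspace V}} :=
  [set u | (a <= u)%VS && (u <= b)%VS && (\dim u == (\dim a).+1)].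

Definition coatoms a b : {set {vspace V}} :=
  [set u | (a <= u)%VS && (u <= b)%VS && ((\dim u).+1 == \dim b)].

Let vectors u : {set finvect_type V} := [set v : finvect_type V | v \in u].
Let outside a u := vectors u :\: vectors a.

(* The type V is destructed because the cardinality lemma for subspaces is
   stated for an explicitly packed vector space. *)
Let card_vectors u : #|vectors u| = (#|F| ^ \dim u)%N.
Proof.
rewrite /vectors; case: (V) u => T c u.
by rewrite cardsE (@card_vspace F (finvect_type (Vector.Pack c)) c).
Qed.

Let card_outside a u : (a <= u)%VS -> #|outside a u| = (#|F| ^ \dim u - #|F| ^ \dim a)%N.
Proof.
move=> au; rewrite -!card_vectors cardsD; congr (_ - #|(_ : {set _})|)%N; apply/setIidPr.
by apply/subsetP => v; rewrite !inE; apply: (subvP au).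
Qed.

Lemma dim_add_line a (v : V) : v \notin a -> \dim (a + <[v]>) = (\dim a).+1.
Proof.
move=> va; rewrite dimv_disjoint_sum ?dim_vline; last first.
  apply/eqP; rewrite -subv0; apply/subvP => w /memv_capP [wa /vlineP [c wE]].
  rewrite memv0; case: (eqVneq c 0) wE => [->|c0] wE; first by rewrite wE scale0r.
  by case/negP: va; rewrite -(scalerK c0 v) -wE memvZ.
by case: (eqVneq v 0) va => [->|_ _]; rewrite ?mem0v ?addn1.
Qed.

(** Each vector of b outside a lies in exactly one cover of a inside b, namely
    a + <[v]>, and each cover u accounts for all vectors of u outside a. *)
Lemma card_atoms a b : (a <= b)%VS ->
  (#|atoms a b| * (#|F| ^ (\dim a).+1 - #|F| ^ \dim a)
     = #|F| ^ \dim b - #|F| ^ \dim a)%N.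
Proof.
move=> ab; rewrite -card_outside // -sum_nat_const.
transitivity (\sum_(u in atoms a b) \sum_(v in outside a b | v \in outside a u) 1)%N.
  apply: eq_bigr => u; rewrite inE => /andP [/andP [au ub] /eqP du].
  rewrite -du -card_outside // sum1dep_card; apply: eq_card => v; rewrite !inE.
  by case: (boolP (v \in u)) => [/(subvP ub) ->|_]; rewrite ?andbF ?andbT ?andbb.
rewrite (exchange_big_dep [in outside a b]) /= => [|u v _ /andP [] //].
rewrite -sum1_card; apply: eq_bigr => v; rewrite !inE => /andP [va vb].
rewrite (big_pred1 (a + <[v : V]>)%VS) // => u /=; rewrite !inE va vb /=.
apply/idP/eqP => [/andP [/andP [/andP [au ub] /eqP du] vu]|->].
  by apply/esym/eqP; rewrite eqEdim subv_add au -memvE vu du dim_add_line //=.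
rewrite dim_add_line // eqxx andbT addvSl subv_add ab -memvE vb /=.
exact: (subvP (addvSr a _) _ (memv_line _)).
Qed.

End Counting.

Section Brackets.
Context {F : finFieldType} {V : vectType F} {R : realFieldType}.
Implicit Types a b u v w : {vspace V}.

Let q : R := #|F|%:R.
Let br := qbracket q.

Lemma q_gt1 : 1 < q.
Proof. by rewrite ltr1n finNzRing_gt1. Qed.

Lemma brE (m : nat) : br m%:Z = (q ^+ m - 1) / (q - 1).
Proof. by []. Qed.

Lemma brB (m p : nat) : br (p%:Z - m%:Z) = (q ^+ p / q ^+ m - 1) / (q - 1).
Proof.
by rewrite /br /qbracket expfzDr ?exprnN // gt_eqF // (lt_trans ltr01) ?q_gt1.
Qed.

Lemma atoms_br a b : (a <= b)%VS ->
  #|atoms a b|%:R = br ((\dim b)%:Z - (\dim a)%:Z) :> R.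
Proof.
move=> ab; have := congr1 (fun m => m%:R : R) (card_atoms _ _ ab).
have q1 := q_gt1.
have q0 : 0 < q by apply: lt_trans q1.
have F0 : (0 < #|F|)%N by rewrite -(ltr0n R).
rewrite natrM !natrB ?leq_pexp2l // ?dimvS // !natrX -/q => e.
rewrite brB; move: e; rewrite exprS.
have : q ^+ \dim a != 0 by rewrite expf_neq0 // gt_eqF.
move: (q ^+ \dim a) (q ^+ \dim b) (_%:R) => A B c A0 e.
have q1' : q - 1 != 0 by rewrite subr_eq0 gt_eqF.
apply: (mulIf (mulf_neq0 A0 q1')).
have -> : c * (A * (q - 1)) = c * (q * A - A) by ring.
by rewrite e; field; rewrite q1'.
Qed.

Lemma br_eq0 (m : nat) : (br m%:Z == 0) = (m == 0)%N.
Proof.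
have q1 := q_gt1.
rewrite brE mulf_eq0 invr_eq0 !subr_eq0 (gt_eqF q1) orbF.
case: m => [|m]; first by rewrite expr0 !eqxx.
by rewrite gt_eqF // exprn_egt1.
Qed.

(** Induction on the codimension of a in b: counting the pairs p <= u of a cover
    p of a and a hyperplane u of b in two ways gives, in codimension d,
    [d] [d - 1] = c [d - 1], where c is the number of hyperplanes. The cancelled
    factor vanishes for d = 1, which is why d = 0 and d = 1 are separate. *)
Lemma coatoms_br a b : (a <= b)%VS ->
  #|coatoms a b|%:R = br ((\dim b)%:Z - (\dim a)%:Z) :> R.
Proof.
have [d le_d] := ubnP (\dim b - \dim a)%N.
elim: d => // d IH in a le_d *; move=> ab.
have dab := dimvS ab.
have [e1|ne] := eqVneq (\dim b) (\dim a).
  rewrite e1 subrr (brE 0) expr0 subrr mul0r.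
  apply/eqP; rewrite pnatr_eq0 cards_eq0 -subset0; apply/subsetP => u.
  by rewrite inE => /andP [/andP [/dimvS au _]]; rewrite e1 => /eqP du; lia.
have [e1|ne1] := eqVneq (\dim b) (\dim a).+1.
  rewrite e1 (_ : coatoms a b = [set a]) ?cards1.
    have -> : (\dim a).+1%:Z - (\dim a)%:Z = 1%N%:Z by lia.
    by rewrite brE expr1 divff // subr_eq0 gt_eqF // q_gt1.
  apply/setP => u; rewrite !inE; apply/idP/eqP => [|->]; last by rewrite subvv ab e1 /=.
  move=> /andP [/andP [au _] /eqP du]; apply/esym/eqP; rewrite eqEdim au /=; lia.
have count : (\sum_(p in atoms a b) #|coatoms p b|
              = \sum_(u in coatoms a b) #|atoms a u|)%N.
  transitivity (\sum_(p in atoms a b) \sum_(u in coatoms a b | (p <= u)%VS) 1)%N.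
    apply: eq_bigr => p; rewrite inE => /andP [/andP [ap pb] /eqP dp].
    rewrite sum1dep_card; apply: eq_card => u; rewrite !inE.
    case: (boolP (p <= u)%VS) => [pu|]; last by rewrite andbF.
    by rewrite (subv_trans ap pu) !andbT.
  rewrite (exchange_big_dep [in coatoms a b]) /= => [|p u _ /andP [] //].
  apply: eq_bigr => u; rewrite inE => /andP [/andP [au ub] du].
  rewrite sum1dep_card; apply: eq_card => p; rewrite !inE.
  case: (boolP (p <= u)%VS) => [pu|]; last by rewrite !andbF.
  by rewrite (subv_trans pu ub) au ub du !andbT.
have := congr1 (fun m => m%:R : R) count; rewrite !natr_sum.
pose m := (\dim b - \dim a).-1.
rewrite (eq_bigr (fun=> br m%:Z)) => [|p]; last first.
  rewrite inE => /andP [/andP [ap pb] /eqP dp]; rewrite IH // ?dp; last by lia.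
  congr br; lia.
rewrite [RHS](eq_bigr (fun=> br m%:Z)) => [|u]; last first.
  rewrite inE => /andP [/andP [au ub] /eqP du]; rewrite atoms_br //.
  congr br; lia.
rewrite !sumr_const -[LHS]mulr_natl -[RHS]mulr_natl => /mulIf <-; rewrite ?atoms_br //.
by rewrite br_eq0; lia.
Qed.
End Brackets.

(** * Distance in a finite graph *)

(** The search for a distance stops at the cardinality of T. A shortest path
    with repetitions removed is still a path, hence still shortest, and being
    duplicate-free it has fewer than #|T| edges: the search reaches it. *)
Lemma gdist_min (T : finType) (e : rel T) (x y : T) (d : nat) :
  (exists p, [/\ path e x p, last x p = y & size p = d]) ->
  (forall p, path e x p -> last x p = y -> d <= size p)%N ->
  gdist e x y = d.
Proof.
move=> [p [ep lp sp]] min_d.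
have d_lt : (d < #|T|)%N.
  move: lp; case: (shortenP ep) => p' ep' up' _ lp'.
  apply: leq_ltn_trans (min_d _ ep' lp') _.
  by rewrite -[(size p').+1]/(size (x :: p')) -(card_uniqP up') max_card.
rewrite /gdist; set a := (fun m => _).
have ad : a d.
  by apply/existsP; exists (tcast sp (in_tuple p)); rewrite val_tcast /= ep lp /=.
have na m : (m < d)%N -> a m = false.
  move=> md; apply/existsP => -[t /andP [et /eqP lt]].
  by have := min_d _ et lt; rewrite size_tuple leqNgt md.
have hs : has a (iota 0 #|T|) by apply/hasP; exists d => //; rewrite mem_iota.
have f_lt : (find a (iota 0 #|T|) < #|T|)%N by rewrite -[X in (_ < X)%N](size_iota 0) -has_find.
apply/eqP; rewrite eqn_leq; apply/andP; split; rewrite leqNgt; apply/negP => lt_d.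
  by have := before_find 0%N lt_d; rewrite nth_iota // ?ad.
by have := nth_find 0%N hs; rewrite nth_iota // na.
Qed.

(** * Neighbours in the Grassmann graph *)

Section Modular.
Context {K : fieldType} {V : vectType K}.
Implicit Types a b c x y u w : {vspace V}.

Definition nbr x u := (\dim u == \dim x) && ((\dim (x :&: u)).+1 == \dim x).

Lemma eq_dimS a b : (a <= b)%VS -> \dim a = \dim b -> a = b.
Proof. by move=> ab dab; apply/eqP; rewrite eqEdim ab dab /=. Qed.

(** Inside x, the subspaces x :&: y and x :&: u lose at most one dimension by
    intersecting, and their intersection lies in u :&: y. *)
Lemma nbr_capS x u y : nbr x u -> (\dim (x :&: y) <= (\dim (u :&: y)).+1)%N.
Proof.
move=> /andP [_ /eqP dxu].
have := dimv_sum_cap (x :&: y) (x :&: u).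
have s1 : (x :&: y + x :&: u <= x)%VS by rewrite subv_add !capvSl.
have s2 : ((x :&: y) :&: (x :&: u) <= u :&: y)%VS.
  by rewrite subv_cap (subv_trans (capvSr _ _) (capvSr _ _))
             (subv_trans (capvSl _ _) (capvSr _ _)).
have := dimvS s1; have := dimvS s2; lia.
Qed.

Lemma nbr_sym x u : nbr x u = nbr u x.
Proof. by rewrite /nbr capvC; case: eqVneq => [->|]; rewrite ?eqxx // eq_sym => /negPf ->. Qed.

Lemma nbr_dim_add x u : nbr x u -> \dim (x + u) = (\dim x).+1.
Proof. by move=> /andP [/eqP du /eqP dxu]; have := dimv_sum_cap x u; lia. Qed.

Lemma nbr_neq x u : nbr x u -> u != x.
Proof. by move=> /andP [_ /eqP]; apply: contra_eqN => /eqP ->; rewrite capvv; lia. Qed.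

(** This and the next lemma turn membership in an interval ending at a hyperplane
    or at a cover of x into adjacency to x. *)
Lemma nbr_coatom a x : (a <= x)%VS -> (\dim a).+1 = \dim x ->
  forall u, \dim u = \dim x -> (a <= u)%VS -> u != x -> nbr x u /\ (x :&: u)%VS = a.
Proof.
move=> ax da u du au neq.
have acap : (a <= x :&: u)%VS by rewrite subv_cap ax.
have := dimvS acap; have := dimvS (capvSl x u) => l1 l2.
have ne : \dim (x :&: u) <> \dim x.
  move=> e; case/eqP: neq; apply/esym/eq_dimS; last by rewrite du.
  by rewrite -(eq_dimS _ _ (capvSl x u) e) capvSr.
have da2 : \dim a = \dim (x :&: u) by lia.
split; last by apply/esym/eq_dimS.
by rewrite /nbr du -da2 da !eqxx.
Qed.

Lemma nbr_atom b x : (x <= b)%VS -> \dim b = (\dim x).+1 ->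
  forall u, \dim u = \dim x -> (u <= b)%VS -> u != x -> nbr x u /\ (x + u)%VS = b.
Proof.
move=> xb db u du ub neq.
have addb : (x + u <= b)%VS by rewrite subv_add xb.
have := dimvS addb; have := dimvS (addvSl x u) => l1 l2.
have ne : \dim (x + u) <> \dim x.
  move=> e; case/eqP: neq; apply/eq_dimS; last by rewrite du.
  by rewrite {1}(eq_dimS _ _ (addvSl x u) (esym e)) addvSr.
have db2 : \dim (x + u) = \dim b by lia.
split; last by apply/eq_dimS.
by have := dimv_sum_cap x u; rewrite /nbr du eqxx /=; lia.
Qed.

(** Distinct covers of x meet in x, so u :&: w is the intersection of the two
    hyperplanes x :&: u and x :&: w of x. *)
Lemma nbr_cap_far x u w : nbr x u -> nbr x w ->
  (x :&: u)%VS != (x :&: w)%VS -> (x + u)%VS != (x + w)%VS ->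
  (\dim (u :&: w)).+2 = \dim x.
Proof.
move=> nu nw neH neU.
have /andP [/eqP du /eqP du1] := nu; have /andP [/eqP dw /eqP dw1] := nw.
have capU : ((x + u) :&: (x + w))%VS = x.
  have s : (x <= (x + u) :&: (x + w))%VS by rewrite subv_cap !addvSl.
  apply/esym/eq_dimS => //; have l := dimvS s.
  have l2 := dimvS (capvSl (x + u) (x + w)).
  have := nbr_dim_add _ _ nu; have := nbr_dim_add _ _ nw => e1 e2.
  apply/eqP; apply: contraNT neU => ne.
  have e : \dim ((x + u) :&: (x + w)) = \dim (x + u) by lia.
  have e' := eq_dimS _ _ (capvSl _ _) e.
  by apply/eqP/eq_dimS; [rewrite -e' capvSr | rewrite e1 e2].
have uwx : (u :&: w <= x)%VS.
  by rewrite -capU; apply: capvS; apply: addvSr.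
have -> : (u :&: w = (x :&: u) :&: (x :&: w))%VS.
  apply/eqP; rewrite eqEsubv !subv_cap uwx capvSl capvSr /=.
  by rewrite (subv_trans (capvSl _ _) (capvSr _ _)) (subv_trans (capvSr _ _) (capvSr _ _)).
have s : (x :&: u + x :&: w <= x)%VS by rewrite subv_add !capvSl.
have l := dimvS s; have l1 := dimvS (addvSl (x :&: u) (x :&: w)).
have := dimv_sum_cap (x :&: u) (x :&: w).
have ne : \dim (x :&: u + x :&: w) <> \dim (x :&: u).
  move=> e; case/eqP: neH; have e' := eq_dimS _ _ (addvSl _ (x :&: w)) (esym e).
  apply/esym/eq_dimS; last lia.
  by rewrite [X in (_ <= X)%VS]e' addvSr.
lia.
Qed.

(** Either u and w contain a common hyperplane of x, or they are distinct
    hyperplanes of a common cover of x. *)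
Lemma nbr_cap_near x u w : nbr x u -> nbr x w -> u != w ->
  ((x :&: u)%VS == (x :&: w)%VS) || ((x + u)%VS == (x + w)%VS) ->
  (\dim (u :&: w)).+1 = \dim x.
Proof.
move=> nu nw neq.
have /andP [/eqP du /eqP du1] := nu; have /andP [/eqP dw /eqP dw1] := nw.
have l : (\dim (u :&: w) < \dim x)%N.
  rewrite ltnNge; apply: contra neq => l; apply/eqP.
  have e : \dim (u :&: w) = \dim u by have := dimvS (capvSl u w); lia.
  apply: eq_dimS; last by rewrite du dw.
  by rewrite -(eq_dimS _ _ (capvSl u w) e) capvSr.
case/orP => /eqP e.
  have s : (x :&: u <= u :&: w)%VS by rewrite subv_cap capvSr e capvSr.
  by have := dimvS s; lia.
have s : (u + w <= x + u)%VS by rewrite subv_add addvSr e addvSr.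
have := dimvS s; rewrite (nbr_dim_add _ _ nu); have := dimv_sum_cap u w; lia.
Qed.

End Modular.

(** * Distance in the Grassmann graph *)

Section Distance.
Context {F : finFieldType} {V : vectType F}.

(** Take z = H + L with H a hyperplane of x and L a subspace of y covering
    x :&: y, both containing x :&: y. They exist because their number, counted
    in the rationals, is a nonzero bracket. *)
Lemma nbr_closer (x y : {vspace V}) : \dim y = \dim x -> (\dim (x :&: y) < \dim x)%N ->
  exists2 z, nbr x z & \dim (z :&: y) = (\dim (x :&: y)).+1.
Proof.
move=> dy lt.
have c0 : qbracket (#|F|%:R : rat) ((\dim x)%:Z - (\dim (x :&: y))%:Z) != 0.
  by rewrite subzn ?br_eq0; lia.
have /set0Pn [H] : coatoms (x :&: y) x != set0.
  by rewrite -cards_eq0 -(pnatr_eq0 rat) coatoms_br ?capvSl.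
have /set0Pn [L] : atoms (x :&: y) y != set0.
  by rewrite -cards_eq0 -(pnatr_eq0 rat) atoms_br ?capvSr ?dy.
rewrite !inE => /andP [/andP [aL Ly] /eqP dL] /andP [/andP [aH Hx] /eqP dH].
have capHL : (H :&: L)%VS = (x :&: y)%VS.
  by apply/eqP; rewrite eqEsubv capvS //= subv_cap aH.
have capHy : (H :&: y)%VS = (x :&: y)%VS.
  by apply/eqP; rewrite eqEsubv capvS //= subv_cap aH capvSr.
have dz : \dim (H + L) = \dim x by have := dimv_sum_cap H L; rewrite capHL; lia.
exists (H + L)%VS.
  apply: (proj1 (nbr_coatom H x Hx dH _ dz (addvSl _ _) _)).
  apply/negP => /eqP zx; have /dimvS : (L <= x :&: y)%VS by rewrite subv_cap Ly -zx addvSr.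
  by rewrite dL ltnn.
rewrite addvC -vspace_modl // capHy.
by move/addv_idPl: aL => ->.
Qed.

Lemma grassmannE k (x y : subspace V k) : (0 < k)%N -> grassmann x y = nbr (val x) (val y).
Proof.
move=> k0; rewrite /grassmann /nbr; case: x y => x /= /eqP -> [y /= /eqP ->].
by rewrite eqxx; lia.
Qed.

(** Along an edge the dimension of the intersection with y changes by at most
    one, and by nbr_closer some edge increases it as long as it is less than k. *)
Lemma gdist_grassmann k (x y : subspace V k) : (0 < k)%N ->
  gdist (@grassmann F V k) x y = (k - \dim (val x :&: val y))%N.
Proof.
move=> k0; apply: gdist_min.
  have [d] := ubnP (k - \dim (val x :&: val y)); elim: d x => // d IH x led.
  have [e|ne] := eqVneq (\dim (val x :&: val y)) k.
    exists [::]; rewrite e subnn; split=> //=; apply/val_inj.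
    have /eqP dx := valP x; have /eqP dy := valP y.
    have xc : (val x :&: val y)%VS = val x by apply: eq_dimS; rewrite ?capvSl // e.
    by rewrite -xc; apply: eq_dimS; rewrite ?capvSr // e.
  have dx : \dim (val x) = k := eqP (valP x).
  have dy : \dim (val y) = k := eqP (valP y).
  have lt : (\dim (val x :&: val y) < \dim (val x))%N.
    by have := dimvS (capvSl (val x) (val y)); lia.
  have [|z nz dz] := nbr_closer (val x) (val y) _ lt; first lia.
  have kz : \dim z == k by rewrite -dx; case/andP: nz.
  have [|p [ep lp sp]] := IH (Sub z kz); first by rewrite /= dz; lia.
  exists (Sub z kz :: p); split=> //; first by rewrite /= ep grassmannE // nz.
    by rewrite -[size _]/(size p).+1 sp SubK dz; lia.
move=> p; elim: p x => [|z p IH] x.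
  by rewrite /last => _ ->; rewrite capvv (eqP (valP y)) subnn.
rewrite [path _ _ _]/= [last _ _]/= grassmannE // => /andP [xz zp] lp.
rewrite -[size _]/(size p).+1; rewrite nbr_sym in xz.
have := nbr_capS _ _ (val y) xz; have := IH z zp lp; lia.
Qed.
End Distance.

(** * Neighbours of x farther from y or closer to y *)

Section Fibers.
Context {F : finFieldType} {V : vectType F}.
Implicit Types x y u w H U : {vspace V}.

Definition farther x y : {set {vspace V}} :=
  [set u | nbr x u && ((\dim (u :&: y)).+1 == \dim (x :&: y))].
Definition closer x y : {set {vspace V}} :=
  [set u | nbr x u && (\dim (u :&: y) == (\dim (x :&: y)).+1)].

Lemma farther_nbr x y u : u \in farther x y -> nbr x u.
Proof. by rewrite inE => /andP []. Qed.
Lemma closer_nbr x y u : u \in closer x y -> nbr x u.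
Proof. by rewrite inE => /andP []. Qed.

(** If x :&: y is not below the hyperplane x :&: u of x, the two span x, so that
    x + y <= u + y; thus u :&: y loses a dimension exactly when this inclusion is
    strict, that is, when u is not inside x + y. *)
Lemma fartherE x y u : (u \in farther x y) =
  [&& nbr x u, ~~ (x :&: y <= u)%VS & ~~ (u <= x + y)%VS].
Proof.
rewrite inE; case: (boolP (nbr x u)) => //= nu.
have /andP [/eqP du /eqP dxu] := nu.
have sy := dimv_sum_cap x y; have su := dimv_sum_cap u y.
apply/eqP/andP => [e|[nxy nu']].
  split; apply/negP => s.
    have /dimvS : (x :&: y <= u :&: y)%VS by rewrite subv_cap s capvSr.
    lia.
  have /dimvS : (u + y <= x + y)%VS by rewrite subv_add s addvSr.
  lia.
have l := nbr_capS _ _ y nu.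
have xuy : (x <= u + y)%VS.
  have s : (x :&: u + x :&: y <= x)%VS by rewrite subv_add !capvSl.
  have -> : x = (x :&: u + x :&: y)%VS.
    apply/esym/eq_dimS => //; have := dimvS s.
    have := dimvS (addvSl (x :&: u) (x :&: y)) => l1 l2.
    suff : \dim (x :&: u) <> \dim (x :&: u + x :&: y) by lia.
    move/(eq_dimS _ _ (addvSl _ _)) => e; case/negP: nxy.
    by rewrite (subv_trans (addvSr (x :&: u) _)) // -e capvSr.
  by rewrite addvS ?capvSr.
have s : (x + y <= u + y)%VS by rewrite subv_add xuy addvSr.
have l1 := dimvS s.
suff : \dim (x + y) <> \dim (u + y) by lia.
by move/(eq_dimS _ _ s) => e; case/negP: nu'; rewrite e addvSl.
Qed.

(** Since x :&: u is a hyperplane of u, it meets u :&: y in at least the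
    dimension of x :&: y. A comparison of dimensions then turns the inclusions of
    that intersection in x :&: y, and of (x :&: u) + (u :&: y) in u, into
    equalities. *)
Lemma closerP x y u : u \in closer x y ->
  [/\ nbr x u, (x :&: y <= u)%VS & u = (x :&: u + u :&: y)%VS].
Proof.
rewrite inE => /andP [nu /eqP d]; have /andP [/eqP du /eqP dxu] := nu.
have c1 : ((x :&: u) :&: (u :&: y) <= x :&: y)%VS by apply: capvS; rewrite ?capvSl ?capvSr.
have s : (x :&: u + u :&: y <= u)%VS by rewrite subv_add capvSl capvSr.
have l1 := dimvS s; have l2 := dimvS c1.
have e := dimv_sum_cap (x :&: u) (u :&: y).
split=> //; last by apply/esym/eq_dimS => //; lia.
rewrite -(eq_dimS _ _ c1); last lia.
by rewrite (subv_trans (capvSl _ _)) ?capvSr.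
Qed.

(** The hyperplane H of x is recovered as x :&: u because u, not being inside
    x + y, differs from x. *)
Lemma farther_cap_fiber x y H : H \in coatoms 0 x :\: coatoms (x :&: y) x ->
  [set u in farther x y | (x :&: u)%VS == H] = atoms H fullv :\: atoms H (x + y).
Proof.
rewrite !inE sub0v /= => /andP [+ /andP [Hx /eqP dH]]; rewrite Hx dH eqxx !andbT => nH.
apply/setP => u; rewrite inE fartherE !inE subvf andbT.
apply/andP/andP => [[/and3P [nu n1 n2] /eqP e]|[n1 /andP [Hu /eqP du]]].
  have /andP [/eqP du /eqP dxu] := nu.
  have Hu : (H <= u)%VS by rewrite -e capvSr.
  by rewrite Hu (negPf n2) du -e dxu eqxx.
move: n1; rewrite Hu du eqxx andbT /= => n1.
have neq : u != x by apply: contraNneq n1 => ->; rewrite addvSl.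
have [|nu e] := nbr_coatom H x Hx dH u _ Hu neq; first lia.
by split; [rewrite nu n1 andbT; apply: contra nH => s; rewrite -e subv_cap capvSl | apply/eqP].
Qed.

Lemma farther_add_fiber x y U : (x <= U)%VS -> \dim U = (\dim x).+1 -> ~~ (U <= x + y)%VS ->
  [set u in farther x y | (x + u)%VS == U] = coatoms 0 U :\: coatoms (x :&: y) U.
Proof.
move=> xU dU nU; apply/setP => u; rewrite inE fartherE !inE sub0v /=.
apply/andP/andP => [[/and3P [nu n1 n2] /eqP e]|[n1 /andP [uU /eqP du]]].
  have /andP [/eqP du /eqP dxu] := nu.
  by rewrite (negPf n1) /= -e addvSr e dU du eqxx.
move: n1; rewrite uU du eqxx !andbT => n1.
have neq : u != x by apply: contraNneq n1 => ->; rewrite capvSl.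
have [|nu e] := nbr_atom U x xU dU u _ uU neq; first lia.
split; last by apply/eqP.
rewrite nu n1 /=; apply: contra nU => s; by rewrite -e subv_add addvSl.
Qed.

(** With the hyperplane and the cover of w fixed, the remaining choices form a
    line of q + 1 subspaces, one of which is x. *)
Lemma farther_both_fiber x y w : w \in farther x y ->
  [set u in farther x y | ((x :&: u)%VS == (x :&: w)%VS) && ((x + u)%VS == (x + w)%VS)]
    = atoms (x :&: w) (x + w) :\ x.
Proof.
rewrite fartherE => /and3P [nw n1 n2]; have /andP [/eqP dw /eqP dxw] := nw.
have dxw2 := nbr_dim_add _ _ nw.
apply/setP => u; rewrite inE fartherE !inE.
apply/andP/andP => [[/and3P [nu _ _] /andP [/eqP <- /eqP <-]]|[neq /andP [/andP [s1 s2] /eqP du]]].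
  have /andP [/eqP du /eqP dxu] := nu.
  by rewrite (nbr_neq _ _ nu) capvSr addvSr du dxu eqxx.
have [|nu e] := nbr_atom (x + w) x (addvSl _ _) dxw2 u _ s2 neq; first lia.
have [|_ e'] := nbr_coatom (x :&: w) x (capvSl _ _) dxw u _ s1 neq; first lia.
rewrite e e' !eqxx nu /=; split=> //; apply/andP; split.
  apply: contra n1 => s.
  have /subv_trans -> // : (x :&: y <= x :&: u)%VS by rewrite subv_cap capvSl.
  by rewrite e' capvSr.
apply: contra n2 => s.
have : (x + u <= x + y)%VS by rewrite subv_add addvSl.
by rewrite e; apply: subv_trans; apply: addvSr.
Qed.

(** By the modular law x :&: (H + y) = H and u = H + (u :&: y) for every u between
    H and H + y; the dimension of u :&: y follows. *)
Lemma closer_cap_fiber x y H : H \in coatoms (x :&: y) x ->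
  [set u in closer x y | (x :&: u)%VS == H] = atoms H (H + y).
Proof.
rewrite inE => /andP [/andP [aH Hx] /eqP dH].
have capHy : (H :&: y)%VS = (x :&: y)%VS.
  by apply/eqP; rewrite eqEsubv capvS //= subv_cap aH capvSr.
have xHy : (x :&: (H + y))%VS = H.
  by rewrite capvC -vspace_modl // capvC; apply/addv_idPl.
apply/setP => u; rewrite in_set [RHS]in_set.
apply/andP/idP => [[uC /eqP e]|/andP [/andP [Hu uHy] /eqP du]].
  have [nu s ue] := closerP x y u uC.
  have /andP [/eqP du /eqP dxu] := nu.
  by rewrite -e capvSr du -dxu eqxx andbT /= {1}ue; apply: addvS; rewrite ?capvSr.
have neq : u != x.
  apply: contraTneq uHy => ->; apply: contraTN isT => s.
  by move/capv_idPl: s; rewrite xHy => e; move: dH; rewrite e; lia.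
have [|nu e] := nbr_coatom H x Hx dH u _ Hu neq; first lia.
split; last by apply/eqP.
rewrite inE nu /=; have ue : u = (H + u :&: y)%VS.
  by rewrite capvC vspace_modl //; apply/esym/capv_idPr.
have := dimv_sum_cap H (u :&: y); rewrite -ue.
have -> : (H :&: (u :&: y) = x :&: y)%VS.
  rewrite capvA -capHy; congr (_ :&: _)%VS; exact/capv_idPl.
lia.
Qed.

(** A cover U of x inside x + y meets y in one dimension more than x does, which
    is already the dimension of u :&: y: the cover determines u :&: y. *)
Lemma closer_capy x y w u : w \in closer x y -> u \in closer x y ->
  (x + u)%VS = (x + w)%VS -> (u :&: y)%VS = ((x + w) :&: y)%VS.
Proof.
move=> wC uC <-; have [nu s ue] := closerP x y u uC.
move: uC; rewrite inE => /andP [_ /eqP d].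
apply: eq_dimS; first by rewrite capvS ?addvSr.
have e : (x + u + y)%VS = (x + y)%VS.
  apply/eqP; rewrite eqEsubv !subv_add !addvSr !andbT.
  rewrite addvSl {1}ue subv_add (subv_trans (capvSl _ _) (addvSl _ _)).
  by rewrite (subv_trans (capvSr _ _) (addvSr _ _)) -addvA addvSl.
have := dimv_sum_cap (x + u) y; rewrite e (nbr_dim_add _ _ nu).
have := dimv_sum_cap x y; lia.
Qed.

Lemma closer_add_fiber x y w : w \in closer x y ->
  [set u in closer x y | (x + u)%VS == (x + w)%VS] = coatoms (w :&: y) (x + w).
Proof.
move=> wC; have wL := closer_capy x y w w wC wC erefl.
have [nw s _] := closerP x y w wC; have dxw := nbr_dim_add _ _ nw.
move: (wC); rewrite inE => /andP [_ /eqP dL].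
apply/setP => u; rewrite in_set [RHS]in_set.
apply/andP/idP => [[uC /eqP e]|/andP [/andP [Lu uU] /eqP du]].
  have [nu _ _] := closerP x y u uC; have /andP [/eqP du _] := nu.
  by rewrite wL -(closer_capy x y w u wC uC e) capvSl -e addvSr /= e dxw du.
have neq : u != x.
  apply: contraTneq Lu => ->; apply: contraTN isT => s'.
  have /dimvS : (w :&: y <= x :&: y)%VS by rewrite subv_cap s' capvSr.
  by rewrite dL ltnn.
have [|nu e] := nbr_atom (x + w) x (addvSl _ _) dxw u _ uU neq; first lia.
split; last by apply/eqP.
rewrite inE nu -dL /=; apply/eqP; congr (\dim _).
apply/eqP; rewrite eqEsubv [X in _ && X]subv_cap Lu capvSr andbT wL.
by rewrite andbT capvS.
Qed.

Lemma closer_both_fiber x y w : w \in closer x y ->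
  [set u in closer x y | ((x :&: u)%VS == (x :&: w)%VS) && ((x + u)%VS == (x + w)%VS)]
    = [set w].
Proof.
move=> wC; apply/setP => u; rewrite in_set in_set1.
apply/andP/eqP => [[uC /andP [/eqP e1 /eqP e2]]|->]; last by rewrite !eqxx.
have [_ _ ue] := closerP x y u uC; have [_ _ we] := closerP x y w wC.
apply: (etrans ue); apply/esym/(etrans we); rewrite e1.
by rewrite (closer_capy x y w u wC uC e2) (closer_capy x y w w wC wC erefl).
Qed.

End Fibers.

(** * Cardinalities and the sum over pairs of neighbours *)

Lemma card_fibers (S T : finType) (A : {set S}) (B : {set T}) (f : S -> T) :
  {in A, forall u, f u \in B} ->
  #|A| = (\sum_(t in B) #|[set u in A | f u == t]|)%N.
Proof.
move=> fAB; rewrite -sum1_card (partition_big f [in B]) //=.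
by apply: eq_bigr => t _; rewrite sum1dep_card.
Qed.

Lemma sum_natr_bool (R : pzRingType) (T : finType) (A : {set T}) (P : pred T) :
  \sum_(u in A) (P u)%:R = #|[set u in A | P u]|%:R :> R.
Proof.
rewrite -sum1_card natr_sum [LHS]big_mkcond [RHS]big_mkcond /=; apply: eq_bigr => u _.
by rewrite inE; case: (u \in A); case: (P u).
Qed.

Lemma natr_cardD (R : pzRingType) (T : finType) (P Q : {set T}) : Q \subset P ->
  #|P :\: Q|%:R = #|P|%:R - #|Q|%:R :> R.
Proof.
by move=> QP; rewrite cardsD (setIidPr QP) natrB // subset_leq_card.
Qed.

Section Moments.
Context {F : finFieldType} {V : vectType F} {R : realFieldType}.
Implicit Types x y u w H U : {vspace V}.

Let q : R := #|F|%:R.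
Let br := qbracket q.

Lemma atoms_sub (a b c : {vspace V}) : (b <= c)%VS -> atoms a b \subset atoms a c.
Proof.
move=> bc; apply/subsetP => u; rewrite !inE => /andP [/andP [-> ub] ->].
by rewrite (subv_trans ub bc).
Qed.

Lemma coatoms_sub (a b c : {vspace V}) : (b <= c)%VS -> coatoms c a \subset coatoms b a.
Proof.
move=> bc; apply/subsetP => u; rewrite !inE => /andP [/andP [cu ->] ->].
by rewrite (subv_trans bc cu).
Qed.

(** With K the dimension of x, and with s1, s2 the indicators of a common
    hyperplane and of a common cover,
    [dim (w :&: u)] = [K - 2] + q^(K - 2) (s1 + s2 - s1 s2 + q (u == w)):
    each dimension gained over K - 2 adds the next power of q. *)
Lemma sum_br_cap x (S : {set {vspace V}}) (a b c : R) :
  (1 < \dim x)%N -> {in S, forall u, nbr x u} ->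
  {in S, forall w, #|[set u in S | (x :&: u)%VS == (x :&: w)%VS]|%:R = a} ->
  {in S, forall w, #|[set u in S | (x + u)%VS == (x + w)%VS]|%:R = b} ->
  {in S, forall w, #|[set u in S | ((x :&: u)%VS == (x :&: w)%VS)
                                && ((x + u)%VS == (x + w)%VS)]|%:R = c} ->
  \sum_(w in S) \sum_(u in S) br (\dim (w :&: u))%:Z
    = #|S|%:R * (#|S|%:R * br ((\dim x)%:Z - 2)
                 + q ^ ((\dim x)%:Z - 2) * (a + b - c + q)).
Proof.
move=> x2 nS Ha Hb Hc.
have q1 : q != 1 by rewrite gt_eqF ?q_gt1.
have q0 : q != 0 by rewrite gt_eqF // (lt_trans ltr01) ?q_gt1.
rewrite [RHS]mulr_natl -sumr_const; apply: eq_bigr => w wS.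
pose s1 u := (x :&: u)%VS == (x :&: w)%VS.
pose s2 u := (x + u)%VS == (x + w)%VS.
have nw := nS w wS; have /andP [/eqP dw _] := nw.
transitivity (\sum_(u in S) (br ((\dim x)%:Z - 2) + q ^ ((\dim x)%:Z - 2) *
   ((s1 u)%:R + (s2 u)%:R - (s1 u && s2 u)%:R + q * (u == w)%:R))).
  apply: eq_bigr => u uS; have nu := nS u uS.
  have brS (m : int) : br (m + 1) = br m + q ^ m.
    rewrite /br /qbracket expfzDr // expr1z; field.
    by rewrite subr_eq0.
  have [->|neq] := eqVneq u w.
    rewrite /s1 /s2 !eqxx capvv dw.
    have -> : br (\dim x)%:Z = br ((\dim x)%:Z - 2 + 1 + 1) by congr br; lia.
    by rewrite !brS [q ^ (_ - 2 + 1)]expfzDr // expr1z /=; ring.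
  case: (boolP (s1 u || s2 u)) => [s12|].
    have := nbr_cap_near x w u nw nu _ _; rewrite eq_sym neq => /(_ isT).
    rewrite eq_sym [(x + w)%VS == _]eq_sym => /(_ s12) dc.
    have -> : (\dim (w :&: u))%:Z = (\dim x)%:Z - 2 + 1 by lia.
    by rewrite brS; case: (s1 u) (s2 u) s12 => [] [] //= _; ring.
  rewrite negb_or => /andP [n1 n2].
  have := nbr_cap_far x u w nu nw n1 n2 => dc.
  have -> : (\dim (w :&: u))%:Z = (\dim x)%:Z - 2 by rewrite capvC; lia.
  by rewrite (negPf n1) (negPf n2) /=; ring.
rewrite big_split /= sumr_const -mulr_sumr; congr (_ + _ * _); first by rewrite mulr_natl.
rewrite !big_split /= sumrN -mulr_sumr !sum_natr_bool Ha // Hb // Hc //.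
have -> : [set u in S | u == w] = [set w].
  by apply/setP => u; rewrite !inE; case: eqVneq => [->|]; rewrite ?wS // andbF.
by rewrite cards1 mulr1.
Qed.

Section Counts.
Variables (x y : {vspace V}).
Hypothesis dxy : \dim y = \dim x.
Let N := (\dim {:V})%:Z.
Let K := (\dim x)%:Z.
Let J := (\dim (x :&: y))%:Z.

Let dim_add : (\dim (x + y))%:Z = K + K - J.
Proof. by rewrite /K /J; have := dimv_sum_cap x y; lia. Qed.

Lemma card_farther_cap H : H \in coatoms 0 x :\: coatoms (x :&: y) x ->
  #|[set u in farther x y | (x :&: u)%VS == H]|%:R
    = br (N - (K - 1)) - br (K + K - J - (K - 1)) :> R.
Proof.
move=> HB; rewrite farther_cap_fiber //.
move: HB; rewrite !inE sub0v /= => /andP [_ /andP [Hx /eqP dH]].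
have Hxy : (H <= x + y)%VS by apply: subv_trans Hx (addvSl _ _).
rewrite natr_cardD ?atoms_sub ?subvf // !atoms_br ?subvf // dim_add.
by congr (br (_ - _) - br (_ - _)); rewrite /K; lia.
Qed.

Lemma farther_cap_coatom u : u \in farther x y ->
  (x :&: u)%VS \in coatoms 0 x :\: coatoms (x :&: y) x.
Proof.
rewrite fartherE !inE sub0v capvSl /= => /and3P [/andP [_ ->] n1 _].
by rewrite !andbT; apply: contra n1 => /subv_trans -> //; rewrite capvSr.
Qed.

Lemma closer_cap_coatom u : u \in closer x y -> (x :&: u)%VS \in coatoms (x :&: y) x.
Proof.
move=> /closerP [/andP [_ d] s _].
by rewrite inE subv_cap capvSl s capvSl d.
Qed.

Lemma card_farther : #|farther x y|%:R
  = (br K - br (K - J)) * (br (N - (K - 1)) - br (K + K - J - (K - 1))) :> R.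
Proof.
rewrite (card_fibers _ _ _ _ _ farther_cap_coatom) natr_sum.
rewrite (eq_bigr _ card_farther_cap) sumr_const -mulr_natl; congr (_ * _).
by rewrite natr_cardD ?coatoms_sub ?sub0v // !coatoms_br ?sub0v ?capvSl // dimv0 subr0.
Qed.

Lemma card_farther_add w : w \in farther x y ->
  #|[set u in farther x y | (x + u)%VS == (x + w)%VS]|%:R
    = br (K + 1) - br (K + 1 - J) :> R.
Proof.
rewrite fartherE => /and3P [nw n1 n2].
have dU := nbr_dim_add _ _ nw.
rewrite farther_add_fiber ?addvSl //; last first.
  by apply: contra n2; apply: subv_trans; rewrite addvSr.
rewrite natr_cardD ?coatoms_sub ?sub0v //.
rewrite !coatoms_br ?sub0v // ?(subv_trans (capvSl _ _) (addvSl _ _)) // dimv0 subr0 dU.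
by congr (br _ - br (_ - _)); rewrite /K; lia.
Qed.

Lemma card_farther_both w : w \in farther x y ->
  #|[set u in farther x y | ((x :&: u)%VS == (x :&: w)%VS)
                         && ((x + u)%VS == (x + w)%VS)]|%:R = q.
Proof.
move=> wB; rewrite farther_both_fiber //.
have nw := farther_nbr _ _ _ wB; have /andP [_ /eqP d] := nw.
rewrite natr_cardD; last first.
  rewrite sub1set inE capvSl addvSl /=; lia.
rewrite cards1 atoms_br; last by rewrite (subv_trans (capvSl _ _) (addvSl _ _)).
rewrite (nbr_dim_add _ _ nw).
have -> : (\dim x).+1%:Z - (\dim (x :&: w))%:Z = 2%N%:Z by lia.
by rewrite brE; field; rewrite subr_eq0 gt_eqF ?q_gt1.
Qed.

Lemma card_closer_cap H : H \in coatoms (x :&: y) x ->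
  #|[set u in closer x y | (x :&: u)%VS == H]|%:R = br (K - J) :> R.
Proof.
move=> HC; rewrite closer_cap_fiber // atoms_br ?addvSl //.
move: HC; rewrite inE => /andP [/andP [aH Hx] /eqP dH].
have capHy : (H :&: y)%VS = (x :&: y)%VS.
  by apply/eqP; rewrite eqEsubv capvS //= subv_cap aH capvSr.
by congr br; have := dimv_sum_cap H y; rewrite capHy /K /J; lia.
Qed.

Lemma card_closer : #|closer x y|%:R = br (K - J) ^+ 2 :> R.
Proof.
rewrite (card_fibers _ _ _ _ _ closer_cap_coatom) natr_sum.
rewrite (eq_bigr _ card_closer_cap) sumr_const -mulr_natl expr2; congr (_ * _).
by rewrite coatoms_br ?capvSl.
Qed.

Lemma card_closer_add w : w \in closer x y ->
  #|[set u in closer x y | (x + u)%VS == (x + w)%VS]|%:R = br (K - J) :> R.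
Proof.
move=> wC; rewrite closer_add_fiber // coatoms_br; last first.
  by rewrite (subv_trans (capvSl _ _) (addvSr _ _)).
rewrite (nbr_dim_add _ _ (closer_nbr _ _ _ wC)).
move: wC; rewrite inE => /andP [_ /eqP ->].
by congr br; rewrite /K /J; lia.
Qed.

Lemma card_closer_both w : w \in closer x y ->
  #|[set u in closer x y | ((x :&: u)%VS == (x :&: w)%VS)
                        && ((x + u)%VS == (x + w)%VS)]|%:R = 1 :> R.
Proof. by move=> wC; rewrite closer_both_fiber // cards1. Qed.

(** The two neighbours share neither their hyperplane of x, as only the second
    contains x :&: y, nor their cover, as only the second lies in x + y. *)
Lemma farther_closer_cap u w : u \in farther x y -> w \in closer x y ->
  (\dim (u :&: w)).+2 = \dim x.
Proof.
move=> uB wC; have nu := farther_nbr _ _ _ uB; have [nw s we] := closerP _ _ _ wC.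
move: uB; rewrite fartherE => /and3P [_ n1 n2].
apply: (nbr_cap_far x) => //.
  apply: contraNneq n1 => e; have : (x :&: y <= x :&: u)%VS by rewrite e subv_cap capvSl s.
  by move/subv_trans; apply; rewrite capvSr.
apply: contraNneq n2 => e; apply: subv_trans (addvSr x u) _; rewrite e.
by rewrite subv_add addvSl we addvS ?capvSl ?capvSr.
Qed.

Lemma sum_br_farther : (1 < \dim x)%N ->
  \sum_(u in farther x y) \sum_(w in farther x y) br (\dim (u :&: w))%:Z
    = #|farther x y|%:R * (#|farther x y|%:R * br (K - 2)
       + q ^ (K - 2) * (br (N - (K - 1)) - br (K + K - J - (K - 1))
                        + (br (K + 1) - br (K + 1 - J)) - q + q)).
Proof.
move=> x2; apply: sum_br_cap => // w wB; first exact: farther_nbr wB.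
- exact/card_farther_cap/farther_cap_coatom.
- exact: card_farther_add.
- exact: card_farther_both.
Qed.

Lemma sum_br_closer : (1 < \dim x)%N ->
  \sum_(u in closer x y) \sum_(w in closer x y) br (\dim (u :&: w))%:Z
    = #|closer x y|%:R * (#|closer x y|%:R * br (K - 2)
       + q ^ (K - 2) * (br (K - J) + br (K - J) - 1 + q)).
Proof.
move=> x2; apply: sum_br_cap => // w wC; first exact: closer_nbr wC.
- exact/card_closer_cap/closer_cap_coatom.
- exact: card_closer_add.
- exact: card_closer_both.
Qed.

End Counts.
End Moments.

(** * Inner products of the vectors attached to subspaces *)

Section Hat.
Context {F : finFieldType} {V : vectType F} {R : realType} {E : vectType R}.
Variables (dot : {dot E for idfun}) (h : subspace V 1 -> E).
Implicit Types u w : {vspace V}.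
Let q : R := #|F|%:R.
Let br := qbracket q.
Let N := (\dim {:V})%:Z.
Hypothesis dot_same : forall s, dot (h s) (h s) = br N - 1.
Hypothesis dot_diff : forall s t, s != t -> dot (h s) (h t) = - 1.

Lemma card_points u : #|[set s : subspace V 1 | (val s <= u)%VS]|%:R = br (\dim u)%:Z :> R.
Proof.
rewrite -(card_imset _ val_inj) (_ : val @: _ = atoms 0 u).
  by rewrite atoms_br ?sub0v // dimv0 subr0.
apply/setP => p; rewrite inE sub0v dimv0 /=; apply/imsetP/andP => [[s]|[pu dp]].
  by rewrite inE => su ->; split=> //; apply: (valP s).
by exists (Sub p dp); rewrite ?inE SubK.
Qed.

Lemma dot_hat u w :
  dot (hat h u) (hat h w) = br N * br (\dim (u :&: w))%:Z - br (\dim u)%:Z * br (\dim w)%:Z.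
Proof.
have dotE s t : dot (h s) (h t) = br N * (s == t)%:R - 1.
  by case: eqVneq => [->|/dot_diff ->]; rewrite ?dot_same ?mulr1 // mulr0 sub0r.
rewrite /hat linear_sumlz.
transitivity (\sum_(s in [set s : subspace V 1 | (val s <= u)%VS])
                 (br N * (val s <= w)%VS%:R - br (\dim w)%:Z)).
  apply: eq_big => [s|s _]; first by rewrite inE.
  rewrite linear_sumr -(eq_bigl _ _ (fun t : subspace V 1 => in_set (fun t => (val t <= w)%VS) t)).
  rewrite (eq_bigr _ (fun t _ => dotE s t)) sumrB sumr_const -mulr_sumr card_points.
  congr (_ * _ - _); rewrite sum_natr_bool; case: (boolP (val s <= w)%VS) => sw.
    rewrite (_ : [set _ in _ | _] = [set s]) ?cards1 //.
    by apply/setP => t; rewrite !inE eq_sym; case: eqVneq => [->|]; rewrite ?sw // andbF.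
  rewrite (_ : [set _ in _ | _] = set0) ?cards0 //.
  by apply/setP => t; rewrite !inE; case: eqVneq => [<-|]; rewrite ?(negPf sw) // andbF.
rewrite sumrB sumr_const -mulr_natl card_points -mulr_sumr sum_natr_bool; congr (_ * _ - _).
rewrite -card_points; congr _%:R; apply: eq_card => s.
by rewrite !inE subv_cap.
Qed.

Lemma dot_hat_sum (k : nat) (A B : {set {vspace V}}) :
  {in A, forall u, \dim u = k} -> {in B, forall u, \dim u = k} ->
  dot (\sum_(u in A) hat h u) (\sum_(w in B) hat h w)
   = br N * (\sum_(u in A) \sum_(w in B) br (\dim (u :&: w))%:Z)
     - #|A|%:R * #|B|%:R * br k%:Z ^+ 2.
Proof.
move=> dA dB; rewrite linear_sumlz mulr_sumr.
have -> : #|A|%:R * #|B|%:R * br k%:Z ^+ 2 = \sum_(u in A) \sum_(w in B) br k%:Z ^+ 2.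
  rewrite (eq_bigr (fun=> #|B|%:R * br k%:Z ^+ 2)) => [|u _]; last by rewrite sumr_const mulr_natl.
  by rewrite sumr_const -[RHS]mulr_natl mulrA.
rewrite -sumrB; apply: eq_bigr => u uA; rewrite linear_sumr mulr_sumr -sumrB.
by apply: eq_bigr => w wB; apply: (etrans (dot_hat u w)); rewrite (dA _ uA) (dB _ wB) expr2.
Qed.

Lemma dot_hat_const (k : nat) (m : int) (A B : {set {vspace V}}) :
  {in A, forall u, \dim u = k} -> {in B, forall u, \dim u = k} ->
  {in A & B, forall u w, (\dim (u :&: w))%:Z = m} ->
  dot (\sum_(u in A) hat h u) (\sum_(w in B) hat h w)
    = #|A|%:R * #|B|%:R * (br N * br m - br k%:Z ^+ 2).
Proof.
move=> dA dB dAB; rewrite (dot_hat_sum k) //.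
rewrite (eq_bigr (fun=> #|B|%:R * br m)) => [|u uA].
  by rewrite sumr_const -[X in _ * X]mulr_natl -/br -/q -/N; ring.
by rewrite mulr_natl -[RHS]sumr_const; apply: eq_bigr => w wB; rewrite dAB.
Qed.

End Hat.

(** * The vertex sets of the theorem as sets of subspaces *)

Section Sums.
Context {F : finFieldType} {V : vectType F} {R : realType} {E : vectType R}.
Variables (h : subspace V 1 -> E) (k : nat) (x y : subspace V k).
Hypothesis lt_xy : (\dim (val x :&: val y) < k)%N.

Lemma calBE z : (z \in calB x y) = (val z \in farther (val x) (val y)).
Proof.
have k0 : (0 < k)%N by lia.
rewrite !inE grassmannE // !gdist_grassmann //.
move: x y z lt_xy => [a da] [b db] [c dc]; rewrite !SubK => lt_ab.
congr (_ && _); have := dimvS (capvSl c b); rewrite [(b :&: c)%VS]capvC; lia.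
Qed.

Lemma calCE z : (z \in calC x y) = (val z \in closer (val x) (val y)).
Proof.
have k0 : (0 < k)%N by lia.
rewrite !inE grassmannE // !gdist_grassmann //.
move: x y z lt_xy => [a da] [b db] [c dc]; rewrite !SubK => lt_ab.
case: (boolP (nbr a c)) => //= n.
have := nbr_capS _ _ b n; rewrite nbr_sym in n; have := nbr_capS _ _ b n.
rewrite [(b :&: c)%VS]capvC; have := dimvS (capvSl c b); lia.
Qed.

Let sum_val (A : {set subspace V k}) (B : {set {vspace V}}) :
  (forall z, (z \in A) = (val z \in B)) -> {in B, forall u, \dim u = k} ->
  \sum_(z in A) hat h (val z) = \sum_(u in B) hat h u.
Proof.
move=> AB dB; rewrite -(big_imset (hat h) (h := val)) /=; last by move=> u v _ _ /val_inj.
apply: eq_bigl => u; apply/imsetP/idP => [[z] zA ->|uB]; first by rewrite -AB.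
have du : \dim u == k by rewrite dB.
by exists (Sub u du); rewrite ?AB SubK.
Qed.

Lemma vecB_sum : vecB h x y = \sum_(u in farther (val x) (val y)) hat h u.
Proof.
apply: sum_val => [z|u /farther_nbr /andP [/eqP -> _]]; first exact: calBE.
exact: eqP (valP x).
Qed.

Lemma vecC_sum : vecC h x y = \sum_(u in closer (val x) (val y)) hat h u.
Proof.
apply: sum_val => [z|u /closer_nbr /andP [/eqP -> _]]; first exact: calCE.
exact: eqP (valP x).
Qed.

End Sums.

(** * The Gram matrix of x, y, B and C *)

Theorem theorem10p15 (F : finFieldType) (V : vectType F) (n k : nat)
    (hn : \dim {:V} = n) (hnk : (2 * k < n)%N) (hk : (6 <= 2 * k)%N)
    (R : realType) (E : vectType R) (dot : {dot E for idfun})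
    (h : subspace V 1 -> E) :
  let q : R := #|F|%:R in
  let br := qbracket q in
  (\dim {:E})%:R = br n%:Z - 1 ->
  <<[seq h s | s : subspace V 1]>>%VS = {:E}%VS ->
  (forall s, dot (h s) (h s) = br n%:Z - 1) ->
  (forall s t, s != t -> dot (h s) (h t) = - 1) ->
  \sum_s h s = 0 ->
  forall (x y : subspace V k) (i : nat),
  gdist (@grassmann F V k) x y = i ->
  (1 < i < k)%N ->
  let N := n%:Z in let K := k%:Z in let I := i%:Z in
  let xh := hat h (val x) in let yh := hat h (val y) in
  let B := vecB h x y in let C := vecC h x y in
  (dot xh xh = q ^ K * br K * br (N - K)) /\
  (dot yh yh = q ^ K * br K * br (N - K)) /\
  (dot xh yh = br N * br (K - I) - br K ^+ 2) /\
  (dot B xh = q ^ (2 * I + 1) * br (K - I) * br (N - K - I)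
              * (br N * br (K - 1) - br K ^+ 2)) /\
  (dot C xh = br I ^+ 2 * (br N * br (K - 1) - br K ^+ 2)) /\
  (dot B yh = q ^ (2 * I + 1) * br (K - I) * br (N - K - I)
              * (br N * br (K - I - 1) - br K ^+ 2)) /\
  (dot C yh = br I ^+ 2 * (br N * br (K - I + 1) - br K ^+ 2)) /\
  (dot B B = q ^ (4 * I + 2) * br (K - I) * br (N - K - I)
              * (q ^ (K - I - 2) * br N * (br (K - I) + br (N - K - I))
                 + br (K - I) * br (N - K - I)
                   * (br N * br (K - 2) - br K ^+ 2))) /\
  (dot B C = q ^ (2 * I + 1) * br (K - I) * br (N - K - I) * br I ^+ 2
              * (br N * br (K - 2) - br K ^+ 2)) /\
  (dot C C = br I ^+ 2
              * (q ^ (K - 2) * br N * (2 * q * br (I - 1) + q + 1)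
                 + br I ^+ 2 * (br N * br (K - 2) - br K ^+ 2))).
Proof.
move=> q br _ _ dot_same dot_diff _ x y i dxyi /andP [i1 ik] N K I xh yh B C.
have k0 : (0 < k)%N by lia.
have dx : \dim (val x) = k := eqP (valP x).
have dy : \dim (val y) = k := eqP (valP y).
have dc : \dim (val x :&: val y) = (k - i)%N.
  by have := gdist_grassmann _ x y k0; rewrite dxyi; lia.
have lt_xy : (\dim (val x :&: val y) < k)%N by lia.
have BE : B = _ := vecB_sum h k x y lt_xy.
have CE : C = _ := vecC_sum h k x y lt_xy.
have xE : xh = \sum_(u in [set val x]) hat h u by rewrite big_set1.
have yE : yh = \sum_(u in [set val y]) hat h u by rewrite big_set1.
rewrite -hn in dot_same.
set SB := farther _ _ in BE; set SC := closer _ _ in CE.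
have dSB : {in SB, forall u, \dim u = k}.
  by move=> u /farther_nbr /andP [/eqP -> _].
have dSC : {in SC, forall u, \dim u = k}.
  by move=> u /closer_nbr /andP [/eqP -> _].
have dSx : {in [set val x], forall u, \dim u = k} by move=> u /set1P ->.
have dSy : {in [set val y], forall u, \dim u = k} by move=> u /set1P ->.
have dyx : \dim (val y) = \dim (val x) by rewrite dx dy.
have x2 : (1 < \dim (val x))%N by rewrite dx; lia.
have J_E : (\dim (val x :&: val y))%:Z = K - I by lia.
have q_neq1 : q - 1 != 0 by rewrite subr_eq0 gt_eqF ?q_gt1.
have q_neq0 : q != 0 by rewrite gt_eqF // (lt_trans ltr01) ?q_gt1.
(* These rules turn every power below into a monomial in q and in the powers of
   q with exponents N, K and I. *)
have qD a b : q ^ (a + b) = q ^ a * q ^ b by rewrite expfzDr.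
have qV a : q ^ (- a) = (q ^ a)^-1 by rewrite -invr_expz.
have qN a : q ^ a != 0 by rewrite expfz_neq0.
have q2 : q ^ 2 = q * q by [].
have qI2 : q ^ (2 * I + 1) = q ^ I * q ^ I * q.
  have -> : 2 * I + 1 = I + I + 1 by ring.
  by rewrite !qD expr1z.
have qI4 : q ^ (4 * I + 2) = (q ^ I * q ^ I * q) ^+ 2.
  have -> : 4 * I + 2 = (2 * I + 1) + (2 * I + 1) by ring.
  by rewrite qD qI2 expr2.
have cB : #|SB|%:R = q ^ (2 * I + 1) * br (K - I) * br (N - K - I).
  rewrite (card_farther _ _ dyx) J_E dx hn -/N -/K -/q qI2 /br /qbracket !(qD, qV) expr1z.
  by field; rewrite !qN q_neq1.
have cC : #|SC|%:R = br I ^+ 2.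
  by rewrite (card_closer _ _ dyx) J_E dx subKr.
have sBB : \sum_(u in SB) \sum_(w in SB) br (\dim (u :&: w))%:Z
    = #|SB|%:R * (#|SB|%:R * br (K - 2)
       + q ^ (2 * I + 1) * q ^ (K - I - 2) * (br (K - I) + br (N - K - I))).
  rewrite (sum_br_farther _ _ dyx x2) J_E dx hn -/N -/K -/q -/br; congr (_ * (_ + _)).
  rewrite qI2 /br /qbracket !(qD, qV) expr1z.
  by field; rewrite !qN q_neq1.
have sCC : \sum_(u in SC) \sum_(w in SC) br (\dim (u :&: w))%:Z
    = #|SC|%:R * (#|SC|%:R * br (K - 2)
       + q ^ (K - 2) * (2 * q * br (I - 1) + q + 1)).
  rewrite (sum_br_closer _ _ dyx x2) J_E dx -/K -/q -/br; congr (_ * (_ + _ * _)).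
  rewrite subKr /br /qbracket !(qD, qV) expr1z.
  by field; rewrite q_neq1 q_neq0.
have cst := dot_hat_const dot h dot_same dot_diff k.
rewrite hn -/N -/K -/q -/br in cst.
have nSB u : u \in SB -> nbr (val x) u by exact: farther_nbr.
have nSC u : u \in SC -> nbr (val x) u by exact: closer_nbr.
have capx u : nbr (val x) u -> (\dim (u :&: val x))%:Z = K - 1.
  by rewrite capvC => /andP [_ /eqP d]; lia.
have capB u : u \in SB -> (\dim (u :&: val y))%:Z = K - I - 1.
  by rewrite inE => /andP [_ /eqP d]; lia.
have capC u : u \in SC -> (\dim (u :&: val y))%:Z = K - I + 1.
  by rewrite inE => /andP [_ /eqP d]; lia.
have br0 : br N * br K - br K ^+ 2 = q ^ K * br K * br (N - K).
  rewrite /br /qbracket !(qD, qV); field; by rewrite qN q_neq1.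
have dotE := dot_hat_sum dot h dot_same dot_diff k.
rewrite hn -/N -/K -/q -/br in dotE.
do ![split].
- by rewrite xE (cst K) // ?cards1 ?mul1r // => u w /set1P -> /set1P ->; rewrite capvv dx.
- by rewrite yE (cst K) // ?cards1 ?mul1r // => u w /set1P -> /set1P ->; rewrite capvv dy.
- by rewrite xE yE (cst (K - I)) // ?cards1 ?mul1r // => u w /set1P -> /set1P ->.
- rewrite BE xE (cst (K - 1)) // ?cards1 ?cB ?mulr1 // => u w uS /set1P ->.
  exact/capx/nSB.
- rewrite CE xE (cst (K - 1)) // ?cards1 ?cC ?mulr1 // => u w uS /set1P ->.
  exact/capx/nSC.
- by rewrite BE yE (cst (K - I - 1)) // ?cards1 ?cB ?mulr1 // => u w uS /set1P ->; apply: capB.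
- by rewrite CE yE (cst (K - I + 1)) // ?cards1 ?cC ?mulr1 // => u w uS /set1P ->; apply: capC.
- by rewrite BE dotE // sBB cB qI4 -qI2; ring.
- rewrite BE CE (cst (K - 2)) // ?cB ?cC // => u w uS wS.
  by have := farther_closer_cap _ _ u w uS wS; lia.
- by rewrite CE dotE // sCC cC; ring.
Qed.
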